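(* Let $A_0A_1A_2$ be a translation triangle in $\mathbf{Nil}$ with translation triangular surface $\mathcal{S}=\mathcal{S}^{\mathbf{Nil},t}_{A_0A_1A_2}$. Let $l$ be a line lying in $\mathcal{S}$ (that is, a connecting curve in $\mathcal{S}$) not through any vertex of the triangle, such that $l$ meets the translation curve $g^{\mathbf{Nil}}_{A_1A_2}$ in $Q$, $g^{\mathbf{Nil}}_{A_0A_2}$ in $R$, and $g^{\mathbf{Nil}}_{A_0A_1}$ in $P$. Then $$s_g^{\mathbf{Nil}}(A_0,P,A_1)\,s_g^{\mathbf{Nil}}(A_1,Q,A_2)\,s_g^{\mathbf{Nil}}(A_2,R,A_0)=-1.$$
   Context: Model. $\mathbf{Nil}$ is $\mathbb{R}^3$ with points $(x,y,z)$, also written $(1,x,y,z)$. The translation by $(x,y,z)$ maps $(a,b,c)\mapsto(x+a,\,y+b,\,z+bx+c)$ and carries the origin to $(x,y,z)$. Fibres are the Euclidean lines parallel to the $z$-axis. Fibrum projection is projection along the fibres. Translation curves. The translation curve starting at the origin with initial tangent vector $(u,v,w)$ is $x(t)=ut$, $y(t)=vt$, $z(t)=\tfrac12uvt^2+wt$, where unit initial velocity means $u^2+v^2+w^2=1$. Translation curves starting at another point $(x_1,y_1,z_1)$ are the images of these under the translation by $(x_1,y_1,z_1)$, i.e. $t\mapsto(x_1+ut,\;y_1+vt,\;z_1+vx_1t+\tfrac12uvt^2+wt)$. Through two distinct points $A,B$ there is a unique translation curve, denoted $g^{\mathbf{Nil}}_{AB}$ (taken as a full curve, $t\in\mathbb{R}$).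 The translation distance $d^{\mathbf{Nil},t}(A,B)$ is the parameter value $t\ge 0$ at which the unit-velocity translation curve starting at $A$ reaches $B$. Simple ratio. For distinct points $A,P,B$ on a translation curve, $s_g^{\mathbf{Nil}}(A,P,B)=d^{\mathbf{Nil},t}(A,P)/d^{\mathbf{Nil},t}(P,B)$ if $P$ is between $A$ and $B$, and $s_g^{\mathbf{Nil}}(A,P,B)=-d^{\mathbf{Nil},t}(A,P)/d^{\mathbf{Nil},t}(P,B)$ otherwise. Triangle and surface. A translation triangle $A_0A_1A_2$ is given by three points not lying on one translation curve; its sides are the translation segments joining pairs of vertices. The surface $\mathcal{S}^{\mathbf{Nil},t}_{A_0A_1A_2}$ is the set of all points $P$ such that the tangent vectors at $P$ of the translation curves from $P$ to $A_0$, $A_1$, $A_2$ are coplanar (vertices included). The triangle is of fibre type if this surface is a Euclidean plane, and of general type otherwise. Connecting curves. For points $P_1,P_2\in\mathcal{S}^{\mathbf{Nil},t}_{A_0A_1A_2}$ the connecting curve $P_1P_2\subset\mathcal{S}^{\mathbf{Nil},t}_{A_0A_1A_2}$ is: (1) the translation curve $g^{\mathbf{Nil}}_{P_1P_2}$ if the triangle is of fibre type; (2) the image of $g^{\mathbf{Nil}}_{P_1P_2}$ in the surface under fibrum projection if the triangle is of general type. *)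

(* Defs.v *)
From mathcomp Require Import all_boot all_order all_algebra.
From mathcomp Require Import ring lra.
From mathcomp Require Import all_classical all_reals all_analysis.

Set Implicit Arguments.
Unset Strict Implicit.
Unset Printing Implicit Defensive.

Import Order.TTheory GRing.Theory Num.Theory.
Import numFieldNormedType.Exports.

Local Open Scope classical_set_scope.
Local Open Scope ring_scope.

Notation nil_point R := 'rV[R]_3.

Section Nil.
Variable R : realType.
Local Notation point := (nil_point R).

Implicit Types (A B P Q T V X Y : point) (C l : set point).

Definition vec3 (x y z : R) : point := \row_i [:: x; y; z]`_i.
Definition xc X : R := X 0 0.
Definition yc X : R := X 0 1.
Definition zc X : R := X 0 2%:R.

Definition translation A X : point :=
  vec3 (xc A + xc X) (yc A + yc X) (zc A + yc X * xc A + zc X).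

Definition origin_curve V (t : R) : point :=
  vec3 (xc V * t) (yc V * t) (xc V * yc V * t ^+ 2 / 2 + zc V * t).

Definition translation_curve A V (t : R) : point :=
  translation A (origin_curve V t).

(* Euclidean norm; the library norm of 'rV[R]_3 is the sup norm. *)
Definition unit_vector V : Prop := xc V ^+ 2 + yc V ^+ 2 + zc V ^+ 2 = 1.

Definition is_translation_curve C : Prop :=
  exists A V, unit_vector V /\ C = range (translation_curve A V).

(* Well defined for A <> B, see [translation_curve_throughP]. *)
Definition translation_curve_through A B : set point :=
  xget set0 [set C | [/\ is_translation_curve C, C A & C B]].

(* Well defined, see [translation_distP]. *)
Definition translation_dist A B : R :=
  xget 0 [set t | 0 <= t /\
                  exists V, unit_vector V /\ translation_curve A V t = B].

Definition between A P B : Prop :=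
  exists V s t, [/\ unit_vector V, 0 < s < t,
    translation_curve A V s = P & translation_curve A V t = B].

Definition simple_ratio A P B : R :=
  if `[< between A P B >] then translation_dist A P / translation_dist P B
  else - (translation_dist A P / translation_dist P B).

Definition translation_triangle A0 A1 A2 : Prop :=
  ~ exists C, [/\ is_translation_curve C, C A0, C A1 & C A2].

Definition tangent_towards P A T : Prop :=
  exists V t, [/\ unit_vector V, 0 < t, translation_curve P V t = A
    & T = derive1 (translation_curve P V) 0].

Definition coplanar (T0 T1 T2 : point) : Prop :=
  (\rank (\matrix_(i < 3) [:: T0; T1; T2]`_i : 'M[R]_3) <= 2)%N.

(* At a vertex one of the three translation curves is degenerate, so the
   vertices are added explicitly. *)
Definition surface A0 A1 A2 : set point :=
  [set P | [\/ P = A0, P = A1 | P = A2] \/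
    exists T0 T1 T2, [/\ tangent_towards P A0 T0, tangent_towards P A1 T1,
                         tangent_towards P A2 T2 & coplanar T0 T1 T2]].

Definition euclidean_plane (S : set point) : Prop :=
  exists N (c : R), N <> 0 /\
    S = [set X | xc N * xc X + yc N * yc X + zc N * zc X = c].

Definition fibre_type A0 A1 A2 : Prop := euclidean_plane (surface A0 A1 A2).

(* Image of [C] in [S] under projection along the fibres. *)
Definition fibrum_image (S C : set point) : set point :=
  [set X | S X /\ exists Y, [/\ C Y, xc Y = xc X & yc Y = yc X]].

Definition connecting_curve A0 A1 A2 (P1 P2 : point) : set point :=
  if `[< fibre_type A0 A1 A2 >] then translation_curve_through P1 P2
  else fibrum_image (surface A0 A1 A2) (translation_curve_through P1 P2).

Definition surface_line A0 A1 A2 l : Prop :=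
  exists P1 P2, [/\ P1 <> P2, surface A0 A1 A2 P1, surface A0 A1 A2 P2
    & l = connecting_curve A0 A1 A2 P1 P2].

Lemma point_eqP X Y : xc X = xc Y -> yc X = yc Y -> zc X = zc Y -> X = Y.
Proof.
move=> hx hy hz; apply/rowP => -[[|[|[|//]]] i3].
- by rewrite (_ : Ordinal i3 = 0) //; exact: val_inj.
- by rewrite (_ : Ordinal i3 = 1) //; exact: val_inj.
- by rewrite (_ : Ordinal i3 = 2%:R) //; exact: val_inj.
Qed.

Lemma vec3E x y z :
  (xc (vec3 x y z) = x) * (yc (vec3 x y z) = y) * (zc (vec3 x y z) = z).
Proof. by rewrite /xc /yc /zc !mxE. Qed.

Lemma coordZ (a : R) X :
  (xc (a *: X) = a * xc X) * (yc (a *: X) = a * yc X) *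
  (zc (a *: X) = a * zc X).
Proof. by rewrite /xc /yc /zc !mxE. Qed.

Lemma translation_curve_coord A V t :
  (xc (translation_curve A V t) = xc A + xc V * t) *
  (yc (translation_curve A V t) = yc A + yc V * t) *
  (zc (translation_curve A V t) = zc A + yc V * xc A * t
     + xc V * yc V * t ^+ 2 / 2 + zc V * t).
Proof. by rewrite /translation_curve /translation !vec3E; do !split; ring. Qed.

Lemma translation_curve0 A V : translation_curve A V 0 = A.
Proof. by apply: point_eqP; rewrite translation_curve_coord; ring. Qed.

Lemma translation_curveD A V s t :
  translation_curve (translation_curve A V s) V t
  = translation_curve A V (s + t).
Proof. by apply: point_eqP; rewrite !translation_curve_coord; field. Qed.

Definition displacement A B : point :=
  vec3 (xc B - xc A) (yc B - yc A)
    (zc B - zc A - (yc B - yc A) * xc A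
       - (xc B - xc A) * (yc B - yc A) / 2).

Lemma displacementP A B V t :
  translation_curve A V t = B <-> t *: V = displacement A B.
Proof.
split=> [<-|e].
  apply: point_eqP; rewrite !coordZ /displacement !(vec3E, translation_curve_coord);
    by field.
have ex := congr1 xc e; have ey := congr1 yc e; have ez := congr1 zc e.
move: ex ey ez; rewrite !coordZ /displacement !vec3E => ex ey ez.
apply: point_eqP; rewrite !translation_curve_coord.
- by rewrite mulrC ex; ring.
- by rewrite mulrC ey; ring.
- transitivity (zc A + (t * yc V) * xc A + (t * xc V) * (t * yc V) / 2
      + t * zc V); first by field.
  by rewrite ex ey ez; field.
Qed.

Definition euclidean_norm X : R :=
  Num.sqrt (xc X ^+ 2 + yc X ^+ 2 + zc X ^+ 2).

Lemma euclidean_normZ (a : R) X :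
  euclidean_norm (a *: X) = `|a| * euclidean_norm X.
Proof.
rewrite /euclidean_norm !coordZ -sqrtr_sqr -sqrtrM ?sqr_ge0 //.
by congr Num.sqrt; ring.
Qed.

Lemma unit_vectorP V : unit_vector V <-> euclidean_norm V = 1.
Proof.
rewrite /unit_vector /euclidean_norm; split=> [->|h]; first by rewrite sqrtr1.
have s0 : 0 <= xc V ^+ 2 + yc V ^+ 2 + zc V ^+ 2.
  by rewrite !addr_ge0 ?sqr_ge0.
by rewrite -(sqr_sqrtr s0) h expr1n.
Qed.

Lemma euclidean_norm_eq0 X : euclidean_norm X = 0 -> X = 0.
Proof.
move=> /eqP; rewrite sqrtr_eq0 => s0.
have := sqr_ge0 (xc X); have := sqr_ge0 (yc X); have := sqr_ge0 (zc X).
move=> hz hy hx.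
by apply: point_eqP; rewrite -[0](scale0r X) coordZ mul0r; apply/eqP;
  rewrite -sqrf_eq0; apply/eqP; lra.
Qed.

Lemma displacement0 A B : displacement A B = 0 -> A = B.
Proof.
move=> d0; rewrite -[LHS](translation_curve0 A (0 : point)).
by apply/displacementP; rewrite d0 scaler0.
Qed.

Lemma displacement_unit A B : exists V, unit_vector V /\
  translation_curve A V (euclidean_norm (displacement A B)) = B.
Proof.
set D := displacement A B.
have [D0|Dn0] := eqVneq (euclidean_norm D) 0.
  exists (vec3 1 0 0); split; first by rewrite /unit_vector !vec3E; ring.
  by rewrite D0 translation_curve0; apply/displacement0/euclidean_norm_eq0.
exists ((euclidean_norm D)^-1 *: D); split.
  apply/unit_vectorP; rewrite euclidean_normZ ger0_norm ?mulVf //.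
  by rewrite invr_ge0 sqrtr_ge0.
by apply/displacementP; rewrite scalerA mulfV // scale1r.
Qed.

Lemma translation_distP A B :
  translation_dist A B = euclidean_norm (displacement A B).
Proof.
apply: xget_unique; first by split; [exact: sqrtr_ge0|exact: displacement_unit].
move=> t [t0 [V [/unit_vectorP V1 /displacementP <-]]].
by rewrite euclidean_normZ V1 mulr1 ger0_norm.
Qed.

Lemma translation_curve_line A V s :
  range (translation_curve (translation_curve A V s) V)
  = range (translation_curve A V).
Proof.
apply/seteqP; split=> _ [t _ <-].
  by rewrite translation_curveD; exists (s + t).
by exists (t - s); rewrite // translation_curveD addrC subrK.
Qed.

Lemma range_translation_curveZ A V (a : R) : a != 0 ->
  range (translation_curve A (a *: V)) = range (translation_curve A V).
Proof.
have E W (b t : R) : translation_curve A (b *: W) t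
    = translation_curve A W (b * t).
  by apply: point_eqP; rewrite !translation_curve_coord !coordZ; field.
move=> a0; apply/seteqP; split=> _ [t _ <-].
  by rewrite E; exists (a * t).
by exists (a^-1 * t); rewrite // E mulVKf.
Qed.

Lemma translation_curve_displacement A B C : A <> B ->
  is_translation_curve C -> C A -> C B ->
  C = range (translation_curve A (displacement A B)).
Proof.
move=> AB [A' [V [V1 ->]]] [s _ As] [t _ Bt].
have sV : (t - s) *: V = displacement A B.
  by apply/displacementP; rewrite -As translation_curveD addrC subrK.
rewrite -sV range_translation_curveZ; last first.
  apply/eqP => ts; apply: AB; apply: displacement0.
  by rewrite -sV ts scale0r.
by rewrite -As translation_curve_line.
Qed.

Lemma translation_curve_throughP A B C : A <> B ->
  [/\ is_translation_curve C, C A & C B] <->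
  C = translation_curve_through A B.
Proof.
move=> AB; rewrite /translation_curve_through.
have [V [V1 VB]] := displacement_unit A B.
set S := [set _ | _].
have SV : S (range (translation_curve A V)).
  split; first by exists A, V.
    by exists 0; rewrite ?translation_curve0.
  by eexists; [|exact: VB].
have SX : S (xget set0 S) by exact: xgetI SV.
split=> [[tC CA CB]|->//]; case: SX => tX XA XB.
by rewrite (translation_curve_displacement AB tC CA CB)
           (translation_curve_displacement AB tX XA XB).
Qed.

Lemma tangent_curveE A V :
  derive1 (translation_curve A V) 0 = vec3 (xc V) (yc V) (zc V + yc V * xc A).
Proof.
apply: cvg_lim => //.
apply: (@cvg_trans _ ((fun h : R =>
   vec3 (xc V) (yc V) (zc V + yc V * xc A)
   + h *: vec3 0 0 (xc V * yc V / 2)) @ 0^')).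
  apply: near_eq_cvg; near=> h.
  have h0 : h != 0 by near: h; exact: nbhs_dnbhs_neq.
  have cD X Y : (xc (X + Y) = xc X + xc Y) * (yc (X + Y) = yc X + yc Y) *
    (zc (X + Y) = zc X + zc Y) by rewrite /xc /yc /zc !mxE.
  have cN X : (xc (- X) = - xc X) * (yc (- X) = - yc X) *
    (zc (- X) = - zc X) by rewrite /xc /yc /zc !mxE.
  by apply: point_eqP; rewrite !(cD, cN, coordZ, vec3E, translation_curve_coord);
    field.
set u := vec3 _ _ (zc V + _); set w := vec3 0 0 _.
have H : u + h *: w @[h --> 0^'] --> u + 0 *: w.
  apply: cvgD; first exact: cvg_cst.
  by apply: cvgZr_tmp; exact: nbhs_dnbhs.
by rewrite scale0r addr0 in H.
Unshelve. all: by end_near. Qed.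

End Nil.

(* Main.v *)
Require Import Defs.
From mathcomp Require Import all_boot all_order all_algebra.
From mathcomp Require Import all_classical all_reals all_analysis.
From mathcomp Require Import ring.
Set Implicit Arguments.
Unset Strict Implicit.
Unset Printing Implicit Defensive.

Import Order.TTheory GRing.Theory Num.Theory.
Local Open Scope classical_set_scope.
Local Open Scope ring_scope.

(** The map [straighten], (x, y, z) |-> (x, y, z - x y / 2), carries the
    translation curves of Nil to the Euclidean lines of the coordinate space,
    with the curve parameter as an affine parameter: along a translation curve
    the quadratic terms of z and of x y / 2 cancel ([straighten_curve]). Three
    things follow.

    - Translation distances on one curve are proportional to differences of the
      affine parameter, so the simple ratio of A, P, B is the affine ratio
      lam / (1 - lam), where lam is the position of the image of P on the line
      from the image of A to that of B ([simple_ratioE]).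

    - The differential of [straighten] at P sends the tangents of the curves
      from P to the vertices to positive multiples of the Euclidean vectors
      towards their images. So the triangular surface is the preimage of the
      Euclidean plane through the images of the vertices ([surfaceP]).

    - If this plane is vertical, the surface is itself a Euclidean plane and
      the triangle is of fibre type; otherwise a point of the surface is
      determined by its fibre, and projecting a translation curve that lies in
      the surface along the fibres onto the surface changes nothing. In both
      cases a connecting curve lies on a single translation curve
      ([surface_line_sub]).

    The images of P, Q, R are therefore collinear, and the theorem is the
    Euclidean theorem of Menelaus for the triangle of the images of the
    vertices. The latter is the identity [cross_menelaus] between vector areas. *)

(** * Vectors in three-space and Menelaus *)

Section Vectors.
Variable K : realType.
Local Notation point := (nil_point K).
Implicit Types (a b c u v w X Y : point).

Lemma coordD X Y :
  (xc (X + Y) = xc X + xc Y) * (yc (X + Y) = yc X + yc Y) *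
  (zc (X + Y) = zc X + zc Y).
Proof. by rewrite /xc /yc /zc !mxE. Qed.

Lemma coordN X :
  (xc (- X) = - xc X) * (yc (- X) = - yc X) * (zc (- X) = - zc X).
Proof. by rewrite /xc /yc /zc !mxE. Qed.

Lemma coord0 : (xc (0 : point) = 0) * (yc (0 : point) = 0) *
  (zc (0 : point) = 0).
Proof. by rewrite /xc /yc /zc !mxE. Qed.

Definition dot u v : K := xc u * xc v + yc u * yc v + zc u * zc v.

Definition cross u v : point :=
  vec3 (yc u * zc v - zc u * yc v) (zc u * xc v - xc u * zc v)
       (xc u * yc v - yc u * xc v).

Definition coordE := (@vec3E K, @coordZ K, coordD, coordN, coord0).

Lemma dot_self_eq0 u : dot u u = 0 -> u = 0.
Proof.
move=> u0; apply: euclidean_norm_eq0; rewrite /euclidean_norm.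
by rewrite !expr2 -/(dot u u) u0 sqrtr0.
Qed.

(** The triple product expansion (u x v) x u = (u . u) v - (u . v) u makes the
    coefficient explicit. *)
Lemma cross0_colinear u v : u != 0 -> cross u v = 0 -> exists k, v = k *: u.
Proof.
move=> u0 uv0; have d0 : dot u u != 0 by apply: contra_neq u0; exact: dot_self_eq0.
have E : dot u u *: v - dot u v *: u = cross (cross u v) u.
  by apply: point_eqP; rewrite /dot /cross !coordE; ring.
have Z : cross 0 u = 0 by apply: point_eqP; rewrite /cross !coordE; ring.
move: E; rewrite uv0 Z => /subr0_eq E.
exists ((dot u u)^-1 * dot u v).
by rewrite -scalerA -E scalerA mulVf // scale1r.
Qed.

Lemma cross_line a w (p q r : K) :
  cross ((a + q *: w) - (a + p *: w)) ((a + r *: w) - (a + p *: w)) = 0.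
Proof. by apply: point_eqP; rewrite /cross !coordE; ring. Qed.

(** Menelaus in terms of vector areas: the factor is the determinant of the
    barycentric coordinates of the points on the sides. When lam, mu and nu
    differ from 1, it vanishes exactly if the product of the ratios
    lam / (1 - lam), mu / (1 - mu), nu / (1 - nu) is -1. *)
Lemma cross_menelaus a b c (lam mu nu : K) :
  let p := a + lam *: (b - a) in
  let q := b + mu *: (c - b) in
  let r := c + nu *: (a - c) in
  cross (q - p) (r - p) =
  ((1 - lam) * (1 - mu) * (1 - nu) + lam * mu * nu) *: cross (b - a) (c - a).
Proof. by move=> p q r; apply: point_eqP; rewrite /cross /p /q /r !coordE; ring. Qed.

Lemma coplanarP u v w : coplanar u v w <-> dot u (cross v w) = 0.
Proof.
rewrite /coplanar; set M : 'M[K]_3 := \matrix_(i < 3) _.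
(* Lists make the column indices of the minors compute. *)
have entryE X (i : 'I_1) j : X i j = [:: xc X; yc X; zc X]`_j.
  have {1}-> : X = vec3 (xc X) (yc X) (zc X) by apply: point_eqP; rewrite coordE.
  by rewrite mxE.
have detM : \det M = dot u (cross v w).
  rewrite (expand_det_row _ 0) !big_ord_recl big_ord0 /cofactor.
  rewrite !(expand_det_row _ 0) !big_ord_recl !big_ord0 /cofactor !det_mx11 !mxE.
  by rewrite !entryE /bump /= /dot /cross !coordE; ring.
have unitM : (\rank M == 3)%N = (\det M != 0).
  by rewrite -unitfE -[_ \is a _]unitmxE -row_free_unit.
rewrite -detM -ltnS ltn_neqAle rank_leq_row andbT unitM negbK.
by split=> /eqP.
Qed.

End Vectors.

(** * Straightening the translation curves *)

Section Straightening.
Variable K : realType.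
Local Notation point := (nil_point K).
Implicit Types (A B P Q X Y V T : point).

Definition straighten X : point := vec3 (xc X) (yc X) (zc X - xc X * yc X / 2).

Lemma straighten_inj : injective straighten.
Proof.
move=> X Y e; have ex := congr1 (@xc K) e; have ey := congr1 (@yc K) e.
have := congr1 (@zc K) e; move: ex ey; rewrite !coordE => ex ey.
by rewrite ex ey => /addIr; exact: point_eqP.
Qed.

(** Along the translate of the curve from the origin with initial tangent
    (u, v, w), both z and x y / 2 have t ^ 2 coefficient u v / 2, so their
    difference is affine in t. *)
Lemma straighten_curve A B (t : K) :
  straighten (translation_curve A (displacement A B) t)
  = straighten A + t *: (straighten B - straighten A).
Proof.
by apply: point_eqP; rewrite /straighten /displacement
  !(coordE, translation_curve_coord); field.
Qed.

Lemma straighten_lineP A B P (t : K) :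
  straighten P = straighten A + t *: (straighten B - straighten A) <->
  translation_curve A (displacement A B) t = P.
Proof.
rewrite -straighten_curve; split=> [e|<-//].
by apply: straighten_inj; rewrite e.
Qed.

Lemma mem_translation_curve_through A B P : A <> B ->
  translation_curve_through A B P <->
  exists t, straighten P = straighten A + t *: (straighten B - straighten A).
Proof.
move=> AB; have [tC CA CB] := (translation_curve_throughP _ AB).2 erefl.
rewrite (translation_curve_displacement AB tC CA CB).
by split=> [[t _ /straighten_lineP]|[t /straighten_lineP]]; exists t.
Qed.

(** The distances from [A] to [P] and from [P] to [B] are |lam| and |1 - lam|
    times that from [A] to [B]. Since [P] is between [A] and [B] exactly when
    0 < lam < 1, that is, when lam / (1 - lam) is positive, the sign convention
    restores the sign that the distances lose. At lam = 1 both sides are 0. *)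
Lemma simple_ratioE A P B (lam : K) : A <> B ->
  straighten P = straighten A + lam *: (straighten B - straighten A) ->
  simple_ratio A P B = lam / (1 - lam).
Proof.
move=> AB /straighten_lineP PE.
set D := displacement A B in PE *.
have N0 : 0 < euclidean_norm D.
  rewrite lt_neqAle sqrtr_ge0 andbT eq_sym; apply/eqP => D0.
  by apply: AB; apply: displacement0; exact: euclidean_norm_eq0.
have AP : displacement A P = lam *: D by symmetry; apply/displacementP.
have PB : displacement P B = (1 - lam) *: D.
  symmetry; apply/displacementP; rewrite -PE translation_curveD subrKC.
  by apply/displacementP; rewrite scale1r.
have dist : translation_dist A P / translation_dist P B
    = `|lam| / `|1 - lam|.
  rewrite !translation_distP AP PB !euclidean_normZ.
  by rewrite -mulf_div divff ?mulr1 // gt_eqF.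
have betweenE : between A P B <-> 0 < lam < 1.
  split=> [[V [s [t [/unit_vectorP V1 /andP[s0 st]]]]]|/andP[l0 l1]].
    move=> /displacementP + /displacementP tV; rewrite AP /D -tV scalerA => e.
    have t0 := lt_trans s0 st.
    have {}e : s = lam * t.
      apply/eqP; rewrite -subr_eq0; apply/negP => /negP slt.
      have : (s - lam * t) *: V = 0 by rewrite scalerBl e subrr.
      move=> /(congr1 (@euclidean_norm K)).
      rewrite euclidean_normZ V1 mulr1 -[0 in RHS](scale0r V) euclidean_normZ.
      by rewrite normr0 mul0r => /normr0_eq0 /eqP; rewrite (negPf slt).
    have -> : lam = s / t by rewrite e mulfK // gt_eqF.
    by rewrite divr_gt0 // ltr_pdivrMr // mul1r.
  have [V [V1 VB]] := displacement_unit A B.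
  exists V, (lam * euclidean_norm D), (euclidean_norm D); split=> //.
    by rewrite mulr_gt0 // gtr_pMl.
  rewrite -PE; apply/displacementP; rewrite -scalerA.
  by move/displacementP: VB => ->; rewrite -/D -AP PE.
rewrite /simple_ratio dist; case: asboolP => [/betweenE/andP[l0 l1]|/betweenE].
  by rewrite !gtr0_norm // subr_gt0.
move=> nb; have [l1|l1] := leP 1 lam.
  rewrite ger0_norm ?(le_trans ler01) // ler0_norm ?subr_le0 //.
  by rewrite invrN mulrN opprK.
have l0 : lam <= 0 by rewrite leNgt; apply/negP => l0; apply: nb; rewrite l0.
by rewrite ler0_norm // gtr0_norm ?subr_gt0 // mulNr opprK.
Qed.

Definition straighten_diff P T : point :=
  vec3 (xc T) (yc T) (zc T - (xc P * yc T + yc P * xc T) / 2).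

(** The differential of [straighten] is unipotent, hence preserves volumes. *)
Lemma dot_cross_diff P T0 T1 T2 (a b c : K) :
  dot (a *: straighten_diff P T0)
      (cross (b *: straighten_diff P T1) (c *: straighten_diff P T2))
  = a * b * c * dot T0 (cross T1 T2).
Proof. by rewrite /dot /cross /straighten_diff !coordE; field. Qed.

(** The curve from [P] to [A] becomes a segment; its constant velocity is the
    image of [T] under the differential at [P]. *)
Lemma tangent_towards_straighten P A T : tangent_towards P A T ->
  exists2 t, 0 < t & straighten A - straighten P = t *: straighten_diff P T.
Proof.
move=> [V [t [_ t0 <- ->]]]; exists t => //; rewrite tangent_curveE.
by apply: point_eqP; rewrite /straighten /straighten_diff
  !(coordE, translation_curve_coord); field.
Qed.

Lemma tangent_towards_ex P A : P <> A -> exists T, tangent_towards P A T.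
Proof.
move=> PA; have [V [V1 VA]] := displacement_unit P A.
eexists; exists V, (euclidean_norm (displacement P A)); split=> //.
rewrite lt_neqAle sqrtr_ge0 andbT eq_sym; apply/eqP => D0.
by apply: PA; apply: displacement0; exact: euclidean_norm_eq0.
Qed.

End Straightening.

(** * The triangular surface and its lines *)

Section Surface.
Variable K : realType.
Local Notation point := (nil_point K).
Variables A0 A1 A2 : point.
Implicit Types (P Q X Y : point) (l : set point).

Definition triangle_normal : point :=
  cross (straighten A1 - straighten A0) (straighten A2 - straighten A0).

Local Notation N := triangle_normal.

(** Both conditions say that the volume spanned by the vectors from the image
    of [X] to the images of the vertices vanishes. *)
Lemma surfaceP X :
  surface A0 A1 A2 X <-> dot N (straighten X - straighten A0) = 0.
Proof.
have volume : dot N (straighten X - straighten A0) =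
    - dot (straighten A0 - straighten X)
        (cross (straighten A1 - straighten X) (straighten A2 - straighten X)).
  by rewrite /triangle_normal /dot /cross !coordE; ring.
have vertex : [\/ X = A0, X = A1 | X = A2] ->
    dot N (straighten X - straighten A0) = 0.
  by case=> ->; rewrite /triangle_normal /dot /cross !coordE; ring.
have coplanarE T0 T1 T2 : tangent_towards X A0 T0 -> tangent_towards X A1 T1 ->
    tangent_towards X A2 T2 ->
    coplanar T0 T1 T2 <-> dot N (straighten X - straighten A0) = 0.
  move=> /tangent_towards_straighten[t0 t0_gt0 e0].
  move=> /tangent_towards_straighten[t1 t1_gt0 e1].
  move=> /tangent_towards_straighten[t2 t2_gt0 e2].
  rewrite volume e0 e1 e2 dot_cross_diff.
  split=> [/coplanarP->|/eqP]; first by rewrite mulr0 oppr0.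
  rewrite oppr_eq0 mulf_eq0 gt_eqF ?mulr_gt0 //=.
  by move=> /eqP/coplanarP.
split=> [[/vertex//|[T0 [T1 [T2 [h0 h1 h2 /(coplanarE _ _ _ h0 h1 h2)]]]]]//|N0].
have [v|nv] := pselect [\/ X = A0, X = A1 | X = A2]; first by left.
right.
have [T0 h0] : exists T, tangent_towards X A0 T.
  by apply: tangent_towards_ex => XA; apply: nv; rewrite XA; constructor 1.
have [T1 h1] : exists T, tangent_towards X A1 T.
  by apply: tangent_towards_ex => XA; apply: nv; rewrite XA; constructor 2.
have [T2 h2] : exists T, tangent_towards X A2 T.
  by apply: tangent_towards_ex => XA; apply: nv; rewrite XA; constructor 3.
by exists T0, T1, T2; split=> //; apply/(coplanarE T0 T1 T2).
Qed.

Hypothesis triangle : translation_triangle A0 A1 A2.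

Lemma triangle_neq : [/\ A0 <> A1, A1 <> A2 & A0 <> A2].
Proof.
have curve (A B : point) :
    exists C, [/\ is_translation_curve C, C A & C B].
  have [V [V1 VB]] := displacement_unit A B.
  exists (range (translation_curve A V)); split; first by exists A, V.
    by exists 0; rewrite ?translation_curve0.
  by eexists; [|exact: VB].
split=> e; apply: triangle.
- by have [C [tC CA CB]] := curve A0 A2; exists C; rewrite -e.
- by have [C [tC CA CB]] := curve A0 A1; exists C; rewrite -e.
- by have [C [tC CA CB]] := curve A0 A1; exists C; rewrite -e.
Qed.

Lemma triangle_normal_neq0 : N <> 0.
Proof.
have [A01 _ _] := triangle_neq => N0.
have u0 : straighten A1 - straighten A0 != 0.
  by rewrite subr_eq0; apply/eqP => /straighten_inj/esym.
have [k e] := cross0_colinear u0 N0.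
have [tC C0 C1] := (translation_curve_throughP _ A01).2 erefl.
apply: triangle; exists (translation_curve_through A0 A1); split=> //.
by apply/(mem_translation_curve_through _ A01); exists k; rewrite -e subrKC.
Qed.

(** When the normal has no vertical component, the term x y / 2 drops out of
    the equation of the surface. *)
Lemma fibre_type_vertical : zc N = 0 -> fibre_type A0 A1 A2.
Proof.
move=> Nz; exists N, (dot N (straighten A0)).
split; first exact: triangle_normal_neq0.
have dotN X : dot N (straighten X - straighten A0)
    = xc N * xc X + yc N * yc X + zc N * zc X - dot N (straighten A0).
  by move: (N) Nz => n nz; rewrite /dot /straighten !coordE nz; ring.
apply/seteqP; split=> X /=.
  by move=> /surfaceP; rewrite dotN => /subr0_eq.
by move=> e; apply/surfaceP; rewrite dotN e subrr.
Qed.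

(** Outside the fibre type, the equation of the surface determines z from x and
    y, and the translation curve through two points of the surface stays in it,
    since its image is a line that meets a plane twice. So the projection along
    the fibres fixes the points of that curve. *)
Lemma surface_line_sub l : surface_line A0 A1 A2 l ->
  exists P1 P2, P1 <> P2 /\ l `<=` translation_curve_through P1 P2.
Proof.
move=> [P1 [P2 [P12 /surfaceP S1 /surfaceP S2 ->]]]; exists P1, P2; split=> //.
rewrite /connecting_curve; case: asboolP => [_|general]; first exact: subset_refl.
have Nz : zc N != 0.
  by apply/eqP => Nz; apply: general; exact: fibre_type_vertical.
move=> X [/surfaceP SX [Y [CY exy eyy]]].
have SY : dot N (straighten Y - straighten A0) = 0.
  have [t ->] := (mem_translation_curve_through _ P12).1 CY.
  transitivity ((1 - t) * dot N (straighten P1 - straighten A0)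
      + t * dot N (straighten P2 - straighten A0)).
    by rewrite /dot !coordE; ring.
  by rewrite S1 S2 !mulr0 addr0.
suff -> : X = Y by [].
apply: point_eqP => //; apply: (mulfI Nz); apply/eqP; rewrite -subr_eq0.
apply/eqP; rewrite -[RHS](subrr 0) -{1}SX -SY /dot /straighten !coordE.
by rewrite exy eyy; ring.
Qed.

End Surface.

(** * The theorem of Menelaus in Nil *)

Theorem theorem3p17 (K : realType) (A0 A1 A2 : nil_point K)
    (triangle : translation_triangle A0 A1 A2)
    (l : set (nil_point K)) (l_line : surface_line A0 A1 A2 l)
    (l_A0 : ~ l A0) (l_A1 : ~ l A1) (l_A2 : ~ l A2)
    (P Q R : nil_point K)
    (l_Q : (l `&` translation_curve_through A1 A2) Q)
    (l_R : (l `&` translation_curve_through A0 A2) R)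
    (l_P : (l `&` translation_curve_through A0 A1) P) :
  simple_ratio A0 P A1 * simple_ratio A1 Q A2 * simple_ratio A2 R A0 = -1.
Proof.
have [A01 A12 A02] := triangle_neq triangle.
have [P1 [P2 [P12 l_sub]]] := surface_line_sub triangle l_line.
case: l_P => lP /(mem_translation_curve_through _ A01)[lam Pe].
case: l_Q => lQ /(mem_translation_curve_through _ A12)[mu Qe].
case: l_R => lR /(mem_translation_curve_through _ A02)[rho Re0].
(* The third side is parametrised from A0 to A2 in the hypothesis, but from A2
   to A0 in the ratio. *)
pose nu := 1 - rho.
have Re : straighten R = straighten A2 + nu *: (straighten A0 - straighten A2).
  by rewrite Re0; apply: point_eqP; rewrite /nu !coordE; ring.
have not_end A B X (t : K) : l X -> ~ l B ->
    straighten X = straighten A + t *: (straighten B - straighten A) -> 1 - t != 0.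
  move=> lX lB Xe; apply/eqP => /subr0_eq t1; apply: lB.
  suff <- : X = B by [].
  by apply: straighten_inj; rewrite Xe -t1 scale1r subrKC.
have lam1 := not_end _ _ _ _ lP l_A1 Pe.
have mu1 := not_end _ _ _ _ lQ l_A2 Qe.
have nu1 := not_end _ _ _ _ lR l_A0 Re.
have := cross_menelaus (straighten A0) (straighten A1) (straighten A2) lam mu nu.
rewrite /= -Pe -Qe -Re.
have [p ->] := (mem_translation_curve_through _ P12).1 (l_sub _ lP).
have [q ->] := (mem_translation_curve_through _ P12).1 (l_sub _ lQ).
have [r ->] := (mem_translation_curve_through _ P12).1 (l_sub _ lR).
rewrite cross_line => /esym/eqP; rewrite scaler_eq0 => /orP[/eqP e|/eqP N0]; last first.
  by case: (triangle_normal_neq0 triangle).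
rewrite (simple_ratioE A01 Pe) (simple_ratioE A12 Qe).
rewrite (simple_ratioE (nesym A02) Re).
rewrite !mulf_div; apply: (canLR (mulfK _)); first by rewrite !mulf_neq0.
by apply/eqP; rewrite mulN1r -addr_eq0 addrC e.
Qed.
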